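(* Let $G$ be a finite simplicial graph with probability-space-vertices, let $(A^G,E^G)$ be the corresponding graph free probability space over $D^G$, and let $x,y\in A^G$ be $G$-random variables which are $G$-free. Then (1) $R^G_{x+y}(z)=\big(R^G_x+R^G_y\big)(z)$; (2) $R^G_{x,y}(z_1,z_2)=R^G_x(z_1)+R^G_y(z_2)$.
   Context: A noncommutative probability space $(A,\varphi)$ is a unital complex algebra $A$ with a linear functional $\varphi:A\to\mathbb{C}$, $\varphi(1)=1$. $G$ is a finite simplicial (undirected, no loops, no multiple edges) graph with vertex set $V(G)$; to each $v\in V(G)$ is attached a noncommutative probability space $(A_v,\varphi_v)$ (a ''probability-space-vertex''). A finite path $[v_1,v_2],[v_2,v_3],\dots,[v_k,v_{k+1}]$ (successive edges of $G$) is denoted $w=[v_1,\dots,v_{k+1}]$, is identified with the reversed path $[v_{k+1},\dots,v_1]$, and has length $|w|=k=|\{v_1,\dots,v_{k+1}\}|-1$. $FP(G)$ is the set of all finite paths of length $\ge 1$, and $\mathbb{F}^+(G)=V(G)\cup FP(G)$. For $w=[v_1,\dots,v_k]\in FP(G)$ put $A_w=A_{v_1}*\cdots*A_{v_k}$ and $\varphi_w=\varphi_{v_1}*\cdots*\varphi_{v_k}$ (usual free product); for a vertex $w$, $(A_w,\varphi_w)$ is the attached space. The graph free product is $A^G=\mathbb{C}\oplus\big(\bigoplus_{w\in\mathbb{F}^+(G)}A_w\big)$ with componentwise operations (a direct sum consisting of all families $\oplus_w a_w$, with unit the family of units); $D^G=\mathbb{C}\oplus\big(\bigoplus_{w\in\mathbb{F}^+(G)}\mathbb{C}_w\big)$,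 $\mathbb{C}_w=\mathbb{C}$; the conditional expectation $E^G:A^G\to D^G$ is $\bigoplus_{w}\varphi_w$ (identity on the first summand $\mathbb{C}$). $(A^G,E^G)$ is the graph free probability space, and elements of $A^G$ are called $G$-random variables. $D^G$ commutes with $A^G$. The $D^G$-valued cumulants are $k_n^{(E^G)}(x_1,\dots,x_n)=\sum_{\pi\in NC(n)}\big(\prod_{V\in\pi}E^G(\prod_{i\in V}x_i)\big)\mu(\pi,1_n)$ (products within a block in increasing order of indices; $NC(n)$ the lattice of noncrossing partitions of $\{1,\dots,n\}$, $\mu$ its Möbius function). Subalgebras $A_1,A_2$ of $A^G$ are $G$-free if all their mixed $D^G$-valued cumulants vanish, i.e. $k_n^{(E^G)}(a_1,\dots,a_n)=0$ whenever $n\ge2$, $a_j\in A_{i_j}$ and $(i_1,\dots,i_n)\in\{1,2\}^n$ is not constant. Elements $x,y$ are $G$-free if the subalgebras generated by $\{x\}\cup D^G$ and $\{y\}\cup D^G$ are $G$-free. The graph R-transform of $x_1,\dots,x_s\in A^G$ is $R^G_{x_1,\dots,x_s}(z_1,\dots,z_s)=\sum_{n=1}^\infty\sum_{(i_1,\dots,i_n)\in\{1,\dots,s\}^n}k_n^{(E^G)}(x_{i_1},\dots,x_{i_n})\,z_{i_1}\cdots z_{i_n}\in D^G[[z_1,\dots,z_s]]$ in noncommuting indeterminates; in particular $R^G_x(z)=\sum_{n\ge1}k_n^{(E^G)}(x,\dots,x)z^n$. *)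

(* Defs.v *)
From HB Require Import structures.
From mathcomp Require Import all_boot all_order all_algebra.
From mathcomp Require Import generic_quotient.

Set Implicit Arguments.
Unset Strict Implicit.
Unset Printing Implicit Defensive.

Import Order.TTheory GRing.Theory Num.Theory.

Local Open Scope ring_scope.
Local Open Scope quotient_scope.

Section Noncrossing.
Variable n : nat.

Definition noncrossing (P : {set {set 'I_n}}) : bool :=
  [forall V in P, forall W in P,
   forall a : 'I_n, forall b : 'I_n, forall c : 'I_n, forall d : 'I_n,
    [&& a < b, b < c, c < d, a \in V, c \in V, b \in W & d \in W]%N ==>
    (V == W)].

Record NC := MkNC {
  blocks :> {set {set 'I_n}};
  blocksP : partition blocks [set: 'I_n] && noncrossing blocks }.

HB.instance Definition _ := [isSub for blocks].
HB.instance Definition _ := [Finite of NC by <:].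

Definition NC_le (P Q : NC) : bool :=
  [forall V in blocks P, exists W in blocks Q, V \subset W].

Lemma NC_leP (P Q : NC) :
  reflect (forall V, V \in blocks P -> exists2 W, W \in blocks Q & V \subset W)
    (NC_le P Q).
Proof.
apply: (iffP forall_inP) => H V /H; first by move/exists_inP.
by move=> HV; apply/exists_inP.
Qed.

Lemma NC_le_refl : reflexive NC_le.
Proof. by move=> P; apply/NC_leP => V PV; exists V. Qed.

Lemma NC_le_trans : transitive NC_le.
Proof.
move=> Q P S /NC_leP PQ /NC_leP QS; apply/NC_leP => V /PQ[W /QS[U SU WU] VW].
by exists U => //; apply: subset_trans WU.
Qed.

Lemma NC_le_anti : antisymmetric NC_le.
Proof.
suff sub (P Q : NC) : NC_le P Q -> NC_le Q P -> blocks P \subset blocks Q.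
  move=> P Q /andP[PQ QP]; apply: val_inj; apply/eqP.
  by rewrite eqEsubset !sub.
move=> /NC_leP PQ /NC_leP QP; apply/subsetP => V PV.
have [W QW VW] := PQ _ PV; have [U PU WU] := QP _ QW.
have /andP[/and3P[_ tP nP] _] := blocksP P.
have [x Vx] : exists x, x \in V.
  by apply/set0Pn; apply: contraNneq nP => <-.
have xU := subsetP (subset_trans VW WU) _ Vx.
have eVU : V = U by rewrite -(def_pblock tP PV Vx) -(def_pblock tP PU xU).
by suff -> : V = W by []; apply/eqP; rewrite eqEsubset VW eVU.
Qed.

Fact NC_display : Order.disp_t. Proof. exact: Order.Disp tt tt. Qed.

HB.instance Definition _ :=
  Order.Le_isPOrder.Build NC_display NC NC_le_refl NC_le_anti NC_le_trans.

(* The one-block partition 1_n (no block at all when n = 0). *)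
Definition NC_one_blocks : {set {set 'I_n}} := [set setT] :\ set0.

Lemma NC_one_blocksP :
  partition NC_one_blocks [set: 'I_n] && noncrossing NC_one_blocks.
Proof.
have in1 V : V \in NC_one_blocks -> V = setT by rewrite !inE => /andP[_ /eqP].
apply/andP; split; last first.
  apply/forall_inP => V /in1->; apply/forall_inP => W /in1->.
  by do 4![apply/forallP => ?]; rewrite eqxx implybT.
apply/and3P; split.
- rewrite eqEsubset subsetT; apply/subsetP => i _.
  apply/bigcupP; exists setT; rewrite !inE ?eqxx ?andbT //.
  by apply/set0Pn; exists i; rewrite inE.
- by apply/trivIsetP => V W /in1-> /in1->; rewrite eqxx.
- by rewrite !inE eqxx.
Qed.

Definition NC_one : NC := MkNC NC_one_blocksP.

Lemma NC_le_one (P : NC) : (P <= NC_one)%O.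
Proof.
apply/NC_leP => V PV; exists setT; rewrite ?subsetT // !inE eqxx andbT.
have /andP[/and3P[_ _ nP] _] := blocksP P.
have /set0Pn[i _] : V != set0 by apply: contraNneq nP => <-.
by apply/set0Pn; exists i; rewrite inE.
Qed.

HB.instance Definition _ := Order.hasTop.Build NC_display NC NC_le_one.

End Noncrossing.

Section Mobius.
Variables (d : Order.disp_t) (T : finPOrderType d).
Implicit Types x y z : T.

(* mu(x,x) = 1 and mu(x,y) = - sum_(x <= z < y) mu(x,z); the recursion stops   *)
(* within #|T| steps.                                                          *)
Fixpoint mobius_rec (m : nat) x y : int :=
  if x == y then 1
  else if m is m'.+1 then - \sum_(z | (x <= z)%O && (z < y)%O) mobius_rec m' x z
  else 0.

Definition mobius x y : int := mobius_rec #|T| x y.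

Lemma mobius_rec_stable m m' x y :
  (#|[set z | (z < y)%O]| <= m)%N -> (#|[set z | (z < y)%O]| <= m')%N ->
  mobius_rec m x y = mobius_rec m' x y.
Proof.
have lt_card z u : (z < u)%O ->
    (#|[set t | (t < z)%O]| < #|[set t | (t < u)%O]|)%N.
  move=> zu; apply: proper_card; apply/properP; split.
    by apply/subsetP => t; rewrite !inE => /lt_trans; apply.
  by exists z; rewrite !inE ?ltxx.
have empty u z : (#|[set t | (t < u)%O]| <= 0)%N -> (z < u)%O = false.
  by rewrite leqn0 cards_eq0 => /eqP/setP/(_ z); rewrite !inE.
elim: m m' y => [|m IH] [|m'] y hm hm' //=; case: eqP => // _.
- by rewrite big1 ?oppr0 // => z /andP[_]; rewrite (empty y).
- by rewrite big1 ?oppr0 // => z /andP[_]; rewrite (empty y).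
- congr (- _); apply: eq_bigr => z /andP[_ /lt_card zy].
  by apply: IH; rewrite -ltnS; apply: leq_trans zy _.
Qed.

Lemma mobius_sum x y : (x <= y)%O ->
  \sum_(z | (x <= z)%O && (z <= y)%O) mobius x z = (x == y)%:R.
Proof.
move=> xy; rewrite (bigD1 y) /=; last by rewrite xy lexx.
have sumE : \sum_(z | (x <= z)%O && (z <= y)%O && (z != y)) mobius x z =
            \sum_(z | (x <= z)%O && (z < y)%O) mobius x z.
  by apply: eq_bigl => z; rewrite -andbA lt_neqAle [_ && (z != y)]andbC.
rewrite sumE; have [e|ne] := eqVneq x y.
  rewrite -e big1 ?addr0 => [|z /andP[xz zx]].
    by rewrite /mobius; case: #|T| => [|m] /=; rewrite eqxx.
  by have := le_lt_trans xz zx; rewrite ltxx.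
rewrite {1}/mobius (@mobius_rec_stable _ #|T|.+1) ?max_card //; last first.
  exact: leq_trans (max_card _) _.
by rewrite /= (negPf ne) addNr.
Qed.

End Mobius.

(* Imported only here: classical_sets redefines setT, set0, partition, etc.     *)
From mathcomp Require Import all_classical all_reals.
From mathcomp Require Import complex.
From mathcomp Require Import ring.

Record ncprob (K : fieldType) := NCProb {
  ncalg :> algType K;
  ncstate : {scalar ncalg};
  ncstate1 : ncstate 1 = 1 }.

Definition scalar_state (K : fieldType) (a : K^o) : K := a.

Lemma scalar_state_is_scalar (K : fieldType) : scalar (@scalar_state K).
Proof. by []. Qed.

HB.instance Definition _ (K : fieldType) :=
  GRing.isLinear.Build K K^o K *%R (@scalar_state K)
    (@scalar_state_is_scalar K).

(* The base field itself, with the identity as state. *)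
Definition scalar_ncprob (K : fieldType) : ncprob K :=
  @NCProb K K^o (@scalar_state K) erefl.

(* The free product of unital algebras is presented by generators and          *)
(* relations: terms over the disjoint union of the algebras, modulo the        *)
(* least algebra congruence that makes each inclusion a unital homomorphism.   *)
Section FreeProduct.
Variables (K : fieldType) (I : eqType) (A : I -> ncprob K).

Inductive fterm : Type :=
| FGen (i : I) of A i
| FOne
| FAdd of fterm & fterm
| FMul of fterm & fterm
| FScale of K & fterm.

Definition FZero := FScale 0 FOne.

Inductive fcong : fterm -> fterm -> Prop :=
| fcong_refl s : fcong s s
| fcong_sym s t : fcong s t -> fcong t s
| fcong_trans s t u : fcong s t -> fcong t u -> fcong s u
| fcong_add s s' t t' : fcong s s' -> fcong t t' -> fcong (FAdd s t) (FAdd s' t')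
| fcong_mul s s' t t' : fcong s s' -> fcong t t' -> fcong (FMul s t) (FMul s' t')
| fcong_scale k s s' : fcong s s' -> fcong (FScale k s) (FScale k s')
| fcong_addA s t u : fcong (FAdd s (FAdd t u)) (FAdd (FAdd s t) u)
| fcong_addC s t : fcong (FAdd s t) (FAdd t s)
| fcong_add0 s : fcong (FAdd FZero s) s
| fcong_addN s : fcong (FAdd (FScale (-1) s) s) FZero
| fcong_mulA s t u : fcong (FMul s (FMul t u)) (FMul (FMul s t) u)
| fcong_mul1l s : fcong (FMul FOne s) s
| fcong_mul1r s : fcong (FMul s FOne) s
| fcong_mulDl s t u : fcong (FMul (FAdd s t) u) (FAdd (FMul s u) (FMul t u))
| fcong_mulDr s t u : fcong (FMul s (FAdd t u)) (FAdd (FMul s t) (FMul s u))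
| fcong_scaleA k l s : fcong (FScale k (FScale l s)) (FScale (k * l) s)
| fcong_scale1 s : fcong (FScale 1 s) s
| fcong_scaleDr k s t :
    fcong (FScale k (FAdd s t)) (FAdd (FScale k s) (FScale k t))
| fcong_scaleDl k l s :
    fcong (FScale (k + l) s) (FAdd (FScale k s) (FScale l s))
| fcong_scaleAl k s t : fcong (FScale k (FMul s t)) (FMul (FScale k s) t)
| fcong_scaleAr k s t : fcong (FScale k (FMul s t)) (FMul s (FScale k t))
| fcong_genD i (a b : A i) : fcong (FGen (a + b)) (FAdd (FGen a) (FGen b))
| fcong_genM i (a b : A i) : fcong (FGen (a * b)) (FMul (FGen a) (FGen b))
| fcong_genZ i k (a : A i) : fcong (FGen (k *: a)) (FScale k (FGen a))
| fcong_gen1 i : fcong (FGen (1 : A i)) FOne.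

Local Notation center a := (a - (ncstate _ a)%:A).

(* The free product state is the vacuum coefficient of the action on the       *)
(* algebraic Fock space spanned by alternating words of centered letters,      *)
(*   a . (b :: w) = center (a b) :: w + phi_i (a b) w     if b lies in A_i,    *)
(*   a . w        = center a :: w + phi_i a w             otherwise,           *)
(* for a in A_i.  To avoid tensor products, [fock_act t f w] is f (t . w), for     *)
(* multilinear f.                                                              *)
Definition fword := seq {i : I & A i}.

Local Notation letter a := (existT (fun k => ncalg (A k) : Type) _ a).

Definition fpeel (i : I) (w : fword) : A i * fword :=
  if w is existT j b :: w' then
    if j =P i is ReflectT e then (eq_rect j (fun k => A k : Type) b i e, w')
    else (1, w)
  else (1, w).

Definition gen_act i (a : A i) (f : fword -> K) (w : fword) : K :=
  let: (b, w') := fpeel i w in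
  f (letter (center (a * b)) :: w') + ncstate _ (a * b) * f w'.

Fixpoint fock_act (t : fterm) (f : fword -> K) : fword -> K :=
  match t with
  | FGen i a => gen_act a f
  | FOne => f
  | FAdd s t => fun w => fock_act s f w + fock_act t f w
  | FMul s t => fock_act t (fock_act s f)
  | FScale k s => fun w => k * fock_act s f w
  end.

Definition vacuum (w : fword) : K := if w is [::] then 1 else 0.

Definition fstate (t : fterm) : K := fock_act t vacuum [::].

Fixpoint reduced (w : fword) : Prop :=
  if w is existT i a :: w' then
    [/\ ncstate _ a = 0,
        (if w' is existT j _ :: _ then i != j else true) & reduced w']
  else True.

Definition multilinear (f : fword -> K) :=
  forall w1 i w2 k (a b : A i),
    f (w1 ++ letter (k *: a + b) :: w2) =
    k * f (w1 ++ letter a :: w2) + f (w1 ++ letter b :: w2).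

Lemma fpeel_eq i (a : A i) w : fpeel i (letter a :: w) = (a, w).
Proof. by rewrite /fpeel; case: eqP => // e; rewrite eq_axiomK. Qed.

Lemma fpeel_neq i j (a : A j) w :
  j != i -> fpeel i (letter a :: w) = (1, letter a :: w).
Proof. by rewrite /fpeel; case: eqP. Qed.

Lemma state_center i (a : A i) : ncstate _ (center a) = 0.
Proof. by rewrite linearB scalarZ ncstate1 mulr1 subrr. Qed.

Lemma centerP i k (a b : A i) : center (k *: a + b) = k *: center a + center b.
Proof. by rewrite linearP scalerDl scalerBr scalerA opprD addrACA. Qed.

Lemma center_id i (a : A i) : ncstate _ a = 0 -> center a = a.
Proof. by move=> ->; rewrite scale0r subr0. Qed.

Lemma multilinear0 f w1 i w2 :
  multilinear f -> f (w1 ++ letter (0 : A i) :: w2) = 0.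
Proof.
by move=> fl; have := fl w1 i w2 (-1) 0 0; rewrite scaler0 addr0 mulN1r addNr.
Qed.

Lemma gen_act_multilinear i (a : A i) f :
  multilinear f -> multilinear (gen_act a f).
Proof.
move=> fl [|[j c] w1] l w2 k x y /=.
  rewrite /gen_act; have [e|ne] := eqVneq l i.
    subst l; rewrite !fpeel_eq mulrDr -scalerAr centerP (fl [::]) linearP /=.
    by ring.
  rewrite !fpeel_neq //= (fl [:: letter _]) (fl [::]) /=.
  by rewrite !mulrDr !(mulrCA k) addrACA.
rewrite /gen_act; have [e|ne] := eqVneq j i.
  subst j; rewrite !fpeel_eq (fl (letter _ :: w1)) fl /=.
  by rewrite !mulrDr !(mulrCA k) addrACA.
rewrite !fpeel_neq //=.
rewrite (fl (letter _ :: letter c :: w1)) (fl (letter c :: w1)) /=.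
by rewrite !mulrDr !(mulrCA k) addrACA.
Qed.

Lemma fock_act_multilinear t f : multilinear f -> multilinear (fock_act t f).
Proof.
elim: t f => [i a|//|s IHs t IHt|s IHs t IHt|c s IHs] f fl /=.
- exact: gen_act_multilinear.
- move=> w1 i w2 k a b; rewrite (IHs _ fl) (IHt _ fl).
  by rewrite mulrDr addrACA.
- by apply/IHt/IHs.
- move=> w1 i w2 k a b; rewrite (IHs _ fl).
  by rewrite mulrDr !(mulrCA k).
Qed.

Lemma vacuum_multilinear : multilinear vacuum.
Proof. by move=> [|x w1] i w2 k a b /=; rewrite mulr0 addr0. Qed.

Variant fpeel_spec i : fword -> A i * fword -> Prop :=
| FPeelIn (a : A i) w of ncstate _ a = 0 & reduced w
    & fpeel i w = (1, w) : fpeel_spec (letter a :: w) (a, w)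
| FPeelOut w of reduced w & fpeel i w = (1, w) : fpeel_spec w (1, w).

Lemma fpeel_reducedP i w : reduced w -> fpeel_spec w (fpeel i w).
Proof.
case: w => [|[j a] w] rw; first exact: FPeelOut.
have [e|ne] := eqVneq j i; last first.
  by rewrite fpeel_neq //; apply: FPeelOut => //; rewrite fpeel_neq.
subst j; rewrite fpeel_eq; case: rw => a0 alt rw; apply: FPeelIn => //.
by case: w alt {rw} => [//|[j b] w] ne; rewrite fpeel_neq // eq_sym.
Qed.

Lemma reduced_cons i (a : A i) w :
  reduced w -> fpeel i w = (1, w) -> reduced (letter (center a) :: w).
Proof.
move=> rw pw; split=> //; first exact: state_center.
case: w rw pw => [//|[j b] w] _ pw.
apply/eqP => e; subst j; move: pw; rewrite fpeel_eq => -[_] /(congr1 size) /=.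
by move/esym/eqP; rewrite eqn_leq ltnn.
Qed.

Lemma fock_act_local t f g :
  (forall w, reduced w -> f w = g w) ->
  forall w, reduced w -> fock_act t f w = fock_act t g w.
Proof.
elim: t f g => [i a|//|s IHs t IHt|s IHs t IHt|c s IHs] f g fg w rw /=.
- rewrite /gen_act; case: (fpeel_reducedP i rw) => [b w' _ rw' pw'|w' rw' pw'].
    by rewrite !fg //; apply: reduced_cons.
  by rewrite !fg //; apply: reduced_cons.
- by rewrite (IHs _ _ fg) // (IHt _ _ fg).
- by apply: IHt => // v rv; apply: IHs.
- by rewrite (IHs _ _ fg).
Qed.

Lemma fock_act_cong s t : fcong s t ->
  forall f w, multilinear f -> reduced w -> fock_act s f w = fock_act t f w.
Proof.
elim=> {s t}.
- by [].
- by move=> s t _ IH f w fl rw; rewrite IH.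
- by move=> s t u _ IH1 _ IH2 f w fl rw; rewrite IH1 ?IH2.
- by move=> s s' t t' _ IH1 _ IH2 f w fl rw /=; rewrite IH1 ?IH2.
- move=> s s' t t' _ IH1 _ IH2 f w fl rw /=.
  rewrite IH2 //; last exact: fock_act_multilinear.
  by apply: fock_act_local => // v rv; apply: IH1.
- by move=> k s s' _ IH f w fl rw /=; rewrite IH.
- by move=> s t u f w _ _ /=; rewrite addrA.
- by move=> s t f w _ _ /=; rewrite addrC.
- by move=> s f w _ _ /=; rewrite mul0r add0r.
- by move=> s f w _ _ /=; rewrite mul0r mulN1r addNr.
- by [].
- by [].
- by [].
- move=> s t u f w _ _ /=; elim: u w (fock_act s f) (fock_act t f) => //=.
  + move=> i a w g h; rewrite /gen_act; case: (fpeel i w) => b v.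
    by rewrite mulrDr addrACA.
  + by move=> u IHu v IHv w g h; rewrite IHu IHv addrACA.
  + by move=> u IHu v IHv w g h; rewrite -IHv; congr fock_act; apply/funext => ?; rewrite IHu.
  + by move=> k u IHu w g h; rewrite IHu mulrDr.
- by [].
- by move=> k l s f w _ _ /=; rewrite mulrA.
- by move=> s f w _ _ /=; rewrite mul1r.
- by move=> k s t f w _ _ /=; rewrite mulrDr.
- by move=> k l s f w _ _ /=; rewrite mulrDl.
- move=> k s t f w _ _ /=; elim: t w (fock_act s f) => //=.
  + move=> i a w g; rewrite /gen_act; case: (fpeel i w) => b v.
    by rewrite mulrDr mulrCA.
  + by move=> u IHu v IHv w g; rewrite -IHu -IHv mulrDr.
  + move=> u IHu v IHv w g; rewrite IHv; congr fock_act.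
    by apply/funext => ?; rewrite IHu.
  + by move=> l u IHu w g; rewrite -IHu mulrCA.
- by [].
- move=> i a b f w fl rw /=; rewrite /gen_act; case: (fpeel i w) => c v.
  have := fl [::] i v 1 (center (a * c)) (center (b * c)).
  rewrite -centerP !scale1r mul1r -mulrDl /= => ->.
  by rewrite mulrDl linearD /= mulrDl addrACA.
- move=> i a b f w fl rw /=; rewrite [in RHS]/gen_act.
  have key c v : fpeel i v = (1, v) ->
      f (letter (center (a * b * c)) :: v) + ncstate _ (a * b * c) * f v =
      gen_act a f (letter (center (b * c)) :: v)
      + ncstate _ (b * c) * gen_act a f v.
    move=> pv; rewrite /gen_act fpeel_eq pv !mulr1.
    have -> : a * center (b * c) = (- ncstate _ (b * c)) *: a + a * b * c.
      by rewrite mulrBr -scalerAr mulr1 mulrA scaleNr addrC.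
    rewrite centerP (fl [::]) linearP /=.
    set u := f (_ :: v); set u' := f (_ :: v); set n := ncstate _ (b * c).
    by ring.
  rewrite /gen_act; case: (fpeel_reducedP i rw) => [c v _ _ pv|v _ pv].
    exact: key.
  exact: key.
- move=> i k a f w fl rw /=; rewrite /gen_act; case: (fpeel i w) => c v.
  have := fl [::] i v k (center (a * c)) 0.
  rewrite addr0 (@multilinear0 f [::]) // addr0 -scalerAl scalarZ.
  by rewrite -scalerA -scalerBr /= => ->; rewrite mulrDr mulrA.
- move=> i f w fl rw /=; rewrite /gen_act.
  case: (fpeel_reducedP i rw) => [a v a0 _ _|v _ _]; rewrite mul1r.
    by rewrite center_id // a0 mul0r addr0.
  by rewrite ncstate1 scale1r subrr (@multilinear0 f [::]) // mul1r add0r.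
Qed.

Lemma fstate_cong s t : fcong s t -> fstate s = fstate t.
Proof. by move=> st; apply: fock_act_cong => //; apply: vacuum_multilinear. Qed.

Lemma fstate_gen i (a : A i) : fstate (FGen a) = ncstate _ a.
Proof. by rewrite /fstate /= /gen_act /= mulr1 add0r mulr1. Qed.

Definition fword_term (w : fword) : fterm :=
  foldr (fun x t => FMul (FGen (tagged x)) t) FOne w.

Lemma fock_act_word w v f :
  reduced (w ++ v) -> fock_act (fword_term w) f v = f (w ++ v).
Proof.
elim: w f => //= -[i a] w IHw f [a0 alt rwv]; rewrite IHw //= /gen_act.
suff -> : fpeel i (w ++ v) = (1, w ++ v).
  by rewrite mulr1 center_id // a0 mul0r addr0.
by case: (w ++ v) alt => [//|[j b] u] ne; rewrite fpeel_neq // eq_sym.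
Qed.

(* Freeness of the factors: the state vanishes on alternating products of      *)
(* centered elements.                                                          *)
Lemma fstate_alternating w :
  reduced w -> w <> [::] -> fstate (fword_term w) = 0.
Proof.
by case: w => // x w rw _; rewrite /fstate fock_act_word cats0.
Qed.

Definition fequiv (s t : {classic fterm}) : bool := `[< fcong s t >].

Lemma fequiv_refl : reflexive fequiv.
Proof. by move=> s; apply/asboolP; exact: fcong_refl. Qed.

Lemma fequiv_sym : symmetric fequiv.
Proof. by move=> s t; apply/asboolP/asboolP; exact: fcong_sym. Qed.

Lemma fequiv_trans : transitive fequiv.
Proof.
move=> s t u /asboolP ts /asboolP su; apply/asboolP; exact: fcong_trans ts su.
Qed.

Canonical fequiv_rel := EquivRel fequiv fequiv_refl fequiv_sym fequiv_trans.

Definition free_prod := {eq_quot fequiv}.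

HB.instance Definition _ : EqQuotient _ fequiv free_prod :=
  EqQuotient.on free_prod.
HB.instance Definition _ := Choice.on free_prod.

Implicit Types x y z : free_prod.

Local Notation cls t := (\pi_free_prod (t : {classic fterm})).

Lemma cls_eq s t : fcong s t -> cls s = cls t.
Proof. by move=> st; apply/eqquotP/asboolP. Qed.

Lemma repr_cls t : fcong (repr (cls t)) t.
Proof.
have /eqquotP/asboolP // : repr (cls t) = t %[mod free_prod] by rewrite reprK.
Qed.

Definition fp_add x y := cls (FAdd (repr x) (repr y)).
Definition fp_mul x y := cls (FMul (repr x) (repr y)).
Definition fp_scale k x := cls (FScale k (repr x)).

Lemma fp_addE s t : fp_add (cls s) (cls t) = cls (FAdd s t).
Proof. by apply: cls_eq; apply: fcong_add; exact: repr_cls. Qed.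

Lemma fp_mulE s t : fp_mul (cls s) (cls t) = cls (FMul s t).
Proof. by apply: cls_eq; apply: fcong_mul; exact: repr_cls. Qed.

Lemma fp_scaleE k s : fp_scale k (cls s) = cls (FScale k s).
Proof. by apply: cls_eq; apply: fcong_scale; exact: repr_cls. Qed.

Lemma fp_addA : associative fp_add.
Proof.
by elim/quotW=> s; elim/quotW=> t; elim/quotW=> u;
  rewrite (fp_addE t u) (fp_addE s t) !fp_addE; apply: cls_eq; constructor.
Qed.

Lemma fp_addC : commutative fp_add.
Proof.
elim/quotW=> s; elim/quotW=> t; rewrite (fp_addE s t) (fp_addE t s).
by apply: cls_eq; constructor.
Qed.

Lemma fp_add0 : left_id (cls FZero) fp_add.
Proof.
by elim/quotW=> s; rewrite fp_addE; apply: cls_eq; exact: fcong_add0.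
Qed.

Lemma fp_addN : left_inverse (cls FZero) (fp_scale (-1)) fp_add.
Proof.
elim/quotW=> s; rewrite (fp_scaleE _ s) fp_addE.
by apply: cls_eq; exact: fcong_addN.
Qed.

HB.instance Definition _ :=
  GRing.isZmodule.Build free_prod fp_addA fp_addC fp_add0 fp_addN.

Lemma fp_mulA : associative fp_mul.
Proof.
by elim/quotW=> s; elim/quotW=> t; elim/quotW=> u;
  rewrite (fp_mulE t u) (fp_mulE s t) !fp_mulE; apply: cls_eq; constructor.
Qed.

Lemma fp_mul1l : left_id (cls FOne) fp_mul.
Proof.
by elim/quotW=> s; rewrite fp_mulE; apply: cls_eq; exact: fcong_mul1l.
Qed.

Lemma fp_mul1r : right_id (cls FOne) fp_mul.
Proof.
by elim/quotW=> s; rewrite fp_mulE; apply: cls_eq; exact: fcong_mul1r.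
Qed.

Lemma fp_mulDl : left_distributive fp_mul +%R.
Proof.
elim/quotW=> s; elim/quotW=> t; elim/quotW=> u; rewrite -[+%R]/fp_add.
rewrite (fp_addE s t) (fp_mulE s u) (fp_mulE t u) fp_mulE fp_addE.
by apply: cls_eq; exact: fcong_mulDl.
Qed.

Lemma fp_mulDr : right_distributive fp_mul +%R.
Proof.
elim/quotW=> s; elim/quotW=> t; elim/quotW=> u; rewrite -[+%R]/fp_add.
rewrite (fp_addE t u) (fp_mulE s t) (fp_mulE s u) fp_mulE fp_addE.
by apply: cls_eq; exact: fcong_mulDr.
Qed.

Lemma fp_one_neq0 : cls FOne != 0 :> free_prod.
Proof.
apply/eqP => /eqquotP/asboolP/fstate_cong; rewrite /fstate /= mul0r.
by move/eqP; rewrite oner_eq0.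
Qed.

HB.instance Definition _ := GRing.Zmodule_isNzRing.Build free_prod
  fp_mulA fp_mul1l fp_mul1r fp_mulDl fp_mulDr fp_one_neq0.

Lemma fp_scaleA k l x : fp_scale k (fp_scale l x) = fp_scale (k * l) x.
Proof.
elim/quotW: x => s; rewrite (fp_scaleE l s) !fp_scaleE.
by apply: cls_eq; exact: fcong_scaleA.
Qed.

Lemma fp_scale1 : left_id 1 fp_scale.
Proof.
by elim/quotW=> s; rewrite fp_scaleE; apply: cls_eq; exact: fcong_scale1.
Qed.

Lemma fp_scaleDr : right_distributive fp_scale +%R.
Proof.
move=> k; elim/quotW=> s; elim/quotW=> t; rewrite -[+%R]/fp_add.
rewrite (fp_addE s t) (fp_scaleE k s) (fp_scaleE k t) fp_scaleE fp_addE.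
by apply: cls_eq; exact: fcong_scaleDr.
Qed.

Lemma fp_scaleDl x : {morph fp_scale^~ x : k l / k + l}.
Proof.
elim/quotW: x => s k l; rewrite -[X in _ = X]/(fp_add _ _).
rewrite (fp_scaleE k s) (fp_scaleE l s) fp_scaleE fp_addE.
by apply: cls_eq; exact: fcong_scaleDl.
Qed.

HB.instance Definition _ := GRing.Zmodule_isLmodule.Build K free_prod
  fp_scaleA fp_scale1 fp_scaleDr fp_scaleDl.

Lemma fp_scaleAl (k : K) x y : k *: (x * y) = k *: x * y.
Proof.
elim/quotW: x => s; elim/quotW: y => t.
rewrite -[LHS]/(fp_scale _ (fp_mul _ _)) -[RHS]/(fp_mul (fp_scale _ _) _).
rewrite (fp_mulE s t) (fp_scaleE k s) fp_scaleE fp_mulE.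
by apply: cls_eq; exact: fcong_scaleAl.
Qed.

HB.instance Definition _ := GRing.Lmodule_isLalgebra.Build K free_prod fp_scaleAl.

Lemma fp_scaleAr (k : K) x y : k *: (x * y) = x * (k *: y).
Proof.
elim/quotW: x => s; elim/quotW: y => t.
rewrite -[LHS]/(fp_scale _ (fp_mul _ _)) -[RHS]/(fp_mul _ (fp_scale _ _)).
rewrite (fp_mulE s t) (fp_scaleE k t) fp_scaleE fp_mulE.
by apply: cls_eq; exact: fcong_scaleAr.
Qed.

HB.instance Definition _ := GRing.Lalgebra_isAlgebra.Build K free_prod fp_scaleAr.

Definition free_state (x : free_prod) : K := fstate (repr x).

Lemma free_state_cls t : free_state (cls t) = fstate t.
Proof. exact/fstate_cong/repr_cls. Qed.

Lemma free_state_is_scalar : scalar free_state.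
Proof.
move=> k; elim/quotW=> s; elim/quotW=> t.
rewrite -[_ *: _ + _]/(fp_add (fp_scale _ _) _) (fp_scaleE k s) fp_addE.
by rewrite !free_state_cls.
Qed.

HB.instance Definition _ :=
  GRing.isLinear.Build K free_prod K *%R free_state free_state_is_scalar.

Lemma free_state1 : free_state 1 = 1.
Proof. exact: free_state_cls. Qed.

Definition free_ncprob : ncprob K := NCProb free_state1.

End FreeProduct.

Record sgraph := SGraph {
  vertex :> finType;
  adj : rel vertex;
  adj_sym : symmetric adj;
  adj_irr : irreflexive adj }.

Section GraphPaths.
Variable G : sgraph.

(* The length of a path, its number of edges, is the number of its vertices    *)
(* minus one: the vertices are pairwise distinct.                              *)
Record spath := SPath {
  pverts :> seq G;
  pvertsP : [&& 1 < size pverts, uniq pverts & sorted (@adj G) pverts]%N }.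

HB.instance Definition _ := [isSub for pverts].
HB.instance Definition _ := [Choice of spath by <:].

Definition spath_rev_eq (p q : spath) : bool :=
  (pverts p == pverts q) || (pverts p == rev (pverts q)).

Lemma spath_rev_eq_refl : reflexive spath_rev_eq.
Proof. by move=> p; rewrite /spath_rev_eq eqxx. Qed.

Lemma spath_rev_eq_sym : symmetric spath_rev_eq.
Proof.
move=> p q; rewrite /spath_rev_eq eq_sym; congr orb.
by rewrite -(inj_eq (can_inj revK)) revK eq_sym.
Qed.

Lemma spath_rev_eq_trans : transitive spath_rev_eq.
Proof.
move=> q p r; rewrite /spath_rev_eq.
by move=> /orP[]/eqP-> /orP[]/eqP->; rewrite ?revK eqxx ?orbT.
Qed.

Canonical spath_rev_equiv :=
  EquivRel spath_rev_eq spath_rev_eq_refl spath_rev_eq_sym spath_rev_eq_trans.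

(* FP(G): paths of positive length up to reversal. *)
Definition fpath_class := {eq_quot spath_rev_eq}.

HB.instance Definition _ : EqQuotient _ spath_rev_eq fpath_class :=
  EqQuotient.on fpath_class.
HB.instance Definition _ := Choice.on fpath_class.

Definition on_path (w : fpath_class) : pred G := [pred v | v \in pverts (repr w)].

Lemma on_path_pi (p : spath) : on_path (\pi p) =i pverts p.
Proof.
move=> v; rewrite inE.
have /eqquotP/orP[/eqP->|/eqP->] : repr (\pi_fpath_class p) = p %[mod fpath_class].
- by rewrite reprK.
- by [].
- by rewrite mem_rev.
Qed.

(* F^+(G) = V(G) + FP(G) *)
Definition fplus := (G + fpath_class)%type.

End GraphPaths.

Section GraphFreeProduct.
Variables (K : fieldType) (G : sgraph) (A : G -> ncprob K).

(* The free product over a path is taken over its set of vertices, which are   *)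
(* pairwise distinct and do not depend on the orientation.                     *)
Definition word_ncprob (w : fplus G) : ncprob K :=
  match w with
  | inl v => A v
  | inr p => free_ncprob (fun v : {v : G | v \in on_path p} => A (val v))
  end.

(* Summands of A^G; [None] is the extra summand C. *)
Definition summand (u : option (fplus G)) : ncprob K :=
  if u is Some w then word_ncprob w else scalar_ncprob K.

Definition graph_alg : Type := forall u : option (fplus G), summand u.

HB.instance Definition _ :=
  Choice.copy graph_alg (forall u : option (fplus G), summand u).

Implicit Types x y z : graph_alg.

Definition ga_zero : graph_alg := fun u => 0.
Definition ga_one : graph_alg := fun u => 1.
Definition ga_opp x : graph_alg := fun u => - x u.
Definition ga_add x y : graph_alg := fun u => x u + y u.
Definition ga_mul x y : graph_alg := fun u => x u * y u.
Definition ga_scale (k : K) x : graph_alg := fun u => k *: x u.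

Lemma ga_addA : associative ga_add.
Proof. by move=> x y z; apply: functional_extensionality_dep => u; apply: addrA. Qed.
Lemma ga_addC : commutative ga_add.
Proof. by move=> x y; apply: functional_extensionality_dep => u; apply: addrC. Qed.
Lemma ga_add0 : left_id ga_zero ga_add.
Proof. by move=> x; apply: functional_extensionality_dep => u; apply: add0r. Qed.
Lemma ga_addN : left_inverse ga_zero ga_opp ga_add.
Proof. by move=> x; apply: functional_extensionality_dep => u; apply: addNr. Qed.

HB.instance Definition _ :=
  GRing.isZmodule.Build graph_alg ga_addA ga_addC ga_add0 ga_addN.

Lemma ga_mulA : associative ga_mul.
Proof. by move=> x y z; apply: functional_extensionality_dep => u; apply: mulrA. Qed.
Lemma ga_mul1l : left_id ga_one ga_mul.
Proof. by move=> x; apply: functional_extensionality_dep => u; apply: mul1r. Qed.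
Lemma ga_mul1r : right_id ga_one ga_mul.
Proof. by move=> x; apply: functional_extensionality_dep => u; apply: mulr1. Qed.
Lemma ga_mulDl : left_distributive ga_mul +%R.
Proof. by move=> x y z; apply: functional_extensionality_dep => u; apply: mulrDl. Qed.
Lemma ga_mulDr : right_distributive ga_mul +%R.
Proof. by move=> x y z; apply: functional_extensionality_dep => u; apply: mulrDr. Qed.
Lemma ga_one_neq0 : ga_one != 0.
Proof.
by apply/eqP => /(congr1 (fun x : graph_alg => x None))/eqP; rewrite oner_eq0.
Qed.

HB.instance Definition _ := GRing.Zmodule_isNzRing.Build graph_alg
  ga_mulA ga_mul1l ga_mul1r ga_mulDl ga_mulDr ga_one_neq0.

Lemma ga_scaleA k l x : ga_scale k (ga_scale l x) = ga_scale (k * l) x.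
Proof. by apply: functional_extensionality_dep => u; apply: scalerA. Qed.
Lemma ga_scale1 : left_id 1 ga_scale.
Proof. by move=> x; apply: functional_extensionality_dep => u; apply: scale1r. Qed.
Lemma ga_scaleDr : right_distributive ga_scale +%R.
Proof. by move=> k x y; apply: functional_extensionality_dep => u; apply: scalerDr. Qed.
Lemma ga_scaleDl x : {morph ga_scale^~ x : k l / k + l}.
Proof. by move=> k l; apply: functional_extensionality_dep => u; apply: scalerDl. Qed.

HB.instance Definition _ := GRing.Zmodule_isLmodule.Build K graph_alg
  ga_scaleA ga_scale1 ga_scaleDr ga_scaleDl.

Lemma ga_scaleAl (k : K) x y : k *: (x * y) = k *: x * y.
Proof. by apply: functional_extensionality_dep => u; apply: scalerAl. Qed.

HB.instance Definition _ :=
  GRing.Lmodule_isLalgebra.Build K graph_alg ga_scaleAl.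

Lemma ga_scaleAr (k : K) x y : k *: (x * y) = x * (k *: y).
Proof. by apply: functional_extensionality_dep => u; apply: scalerAr. Qed.

HB.instance Definition _ :=
  GRing.Lalgebra_isAlgebra.Build K graph_alg ga_scaleAr.

End GraphFreeProduct.

(* D^G, a commutative ring for the pointwise operations. *)
Definition graph_diag (K : fieldType) (G : sgraph) := option (fplus G) -> K.

HB.instance Definition _ (K : fieldType) (G : sgraph) :=
  GRing.ComPzRing.copy (graph_diag K G) (option (fplus G) -> K).

Section GraphProbability.
Variables (K : fieldType) (G : sgraph) (A : G -> ncprob K).

Local Notation AG := (graph_alg A).
Local Notation DG := (graph_diag K G).

Definition graph_E (a : AG) : DG := fun u => ncstate (summand A u) (a u).

(* The inclusion of D^G in A^G. *)
Definition diag_in (c : DG) : AG := fun u => (c u)%:A.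

Definition cumulant (n : nat) (x : n.-tuple AG) : DG :=
  \sum_(P : NC n)
    (\prod_(V in blocks P) graph_E (\prod_(i in V) tnth x i))
      *~ mobius P \top%O.

(* The boolean tuple [c] says which subalgebra each argument is taken from.    *)
Definition G_free_alg (S1 S2 : set AG) : Prop :=
  forall (n : nat) (c : n.-tuple bool) (a : n.-tuple AG),
    (1 < n)%N -> ~~ constant c ->
    (forall j, (if tnth c j then S2 else S1) (tnth a j)) ->
    cumulant a = 0.

Definition generated_alg (X : set AG) : set AG :=
  smallest (fun S : set AG => GRing.subalg_closed (mem S)) X.

Definition G_free (x y : AG) : Prop :=
  G_free_alg (generated_alg ([set x] `|` range diag_in))
             (generated_alg ([set y] `|` range diag_in)).

End GraphProbability.

(* D^G[[z_1, ..., z_s]] in noncommuting indeterminates: a series is the family *)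
(* of its coefficients, indexed by words in the indeterminates.                *)
Definition ncseries (K : fieldType) (G : sgraph) (s : nat) :=
  seq 'I_s -> graph_diag K G.

HB.instance Definition _ (K : fieldType) (G : sgraph) (s : nat) :=
  GRing.Zmodule.copy (ncseries K G s) (seq 'I_s -> graph_diag K G).

Definition graph_R (K : fieldType) (G : sgraph) (A : G -> ncprob K) (s : nat)
    (x : s.-tuple (graph_alg A)) : ncseries K G s :=
  fun w => if w is [::] then 0
           else cumulant (map_tuple (tnth x) (in_tuple w)).

(* f(z_i): the one-variable series f in the indeterminate z_i. *)
Definition in_var (K : fieldType) (G : sgraph) (s : nat) (i : 'I_s)
    (f : ncseries K G 1) : ncseries K G s :=
  fun w => if all (pred1 i) w then f (nseq (size w) ord0) else 0.

(* Main.v *)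
(* Cumulants are additive in each argument, since an index lies in exactly one *)
(* block of a partition.  Expanding k_n(x+y, ..., x+y) one argument at a time  *)
(* from the left, a mixed prefix already forces the term to vanish, so only    *)
(* k_n(x, ..., x) and k_n(y, ..., y) survive.                                  *)
Require Import Defs.
From mathcomp Require Import all_boot all_order all_algebra.
From mathcomp Require Import all_classical all_reals.
From mathcomp Require Import complex.

Set Implicit Arguments.
Unset Strict Implicit.
Unset Printing Implicit Defensive.

Import GRing.Theory.
Local Open Scope ring_scope.

Lemma prodrD_slot (T : pzRingType) (I : eqType) (r : seq I) (P : pred I) (j : I)
    (f g h : I -> T) :
  uniq r -> j \in r -> P j -> h j = f j + g j ->
  (forall i, i != j -> h i = f i /\ h i = g i) ->
  \prod_(i <- r | P i) h i = \prod_(i <- r | P i) f i + \prod_(i <- r | P i) g i.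
Proof.
move=> ur jr Pj hj hi; case/splitPr: jr ur => r1 r2.
rewrite cat_uniq /= negb_or => /and3P[_ /andP[jr1 _] /andP[jr2 _]].
rewrite !big_cat /= !big_cons Pj hj mulrDl mulrDr.
have off s : j \notin s ->
    \prod_(i <- s | P i) h i = \prod_(i <- s | P i) f i /\
    \prod_(i <- s | P i) h i = \prod_(i <- s | P i) g i.
  move=> js; split; rewrite big_seq_cond [RHS]big_seq_cond;
    by apply: eq_bigr => i /andP[si _]; case: (hi i) => //; apply: contraNneq js => <-.
by have [<- <-] := off _ jr1; have [<- <-] := off _ jr2.
Qed.

Section Cumulants.
Variables (K : fieldType) (G : sgraph) (A : G -> ncprob K).
Local Notation AG := (graph_alg A).

Lemma graph_ED (a b : AG) : graph_E (a + b) = graph_E a + graph_E b.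
Proof. by apply/funext => u; rewrite /graph_E raddfD. Qed.

(** For a fixed partition only the block containing [j] changes. As [graph_diag] is commutative, its
    factor can be pulled to the front, where [graph_E] is additive. *)
Lemma cumulantD_slot (n : nat) (j : 'I_n) (z a b : n.-tuple AG) :
  tnth z j = tnth a j + tnth b j ->
  (forall i, i != j -> tnth z i = tnth a i /\ tnth z i = tnth b i) ->
  cumulant z = cumulant a + cumulant b.
Proof.
move=> zj zi; rewrite /cumulant -big_split /=; apply: eq_bigr => P _.
rewrite -mulrzDl; congr (_ *~ _).
have /andP[/and3P[/eqP covP trivP _] _] := blocksP P.
have jP : j \in finset.cover (blocks P) by rewrite covP inE.
have blkP := finset.pblock_mem jP; have jblk : j \in finset.pblock (blocks P) j by rewrite finset.mem_pblock.
rewrite !(bigD1 _ blkP) /=.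
have off (c : n.-tuple AG) : (forall i, i != j -> tnth z i = tnth c i) ->
    \prod_(V in blocks P | V != finset.pblock (blocks P) j) graph_E (\prod_(i in V) tnth z i) =
    \prod_(V in blocks P | V != finset.pblock (blocks P) j) graph_E (\prod_(i in V) tnth c i).
  move=> zc; apply: eq_bigr => V /andP[VP ne]; congr graph_E.
  apply: eq_bigr => i iV; apply: zc; apply: contraNneq ne => ij.
  by rewrite -ij (finset.def_pblock trivP VP iV).
rewrite -(off a) => [|i /zi[]//]; rewrite -(off b) => [|i /zi[]//].
rewrite -mulrDl -graph_ED; congr (graph_E _ * _).
by apply: (prodrD_slot (j := j)) => //; rewrite ?index_enum_uniq ?mem_index_enum.
Qed.

(** Lengths of concatenated lists agree only up to a provable equality; this removes the length from
    the type, so that cumulants can be handled as functions of lists. *)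
Lemma eq_cumulant (n m : nat) (a : n.-tuple AG) (b : m.-tuple AG) :
  tval a = tval b -> cumulant a = cumulant b.
Proof.
case: a b => [s sn] [t tm] /= e; subst t.
have en := eqP sn; have em := eqP tm; subst n m.
by congr cumulant; apply: val_inj.
Qed.

Definition cumulant_seq (s : seq AG) := cumulant (in_tuple s).

Lemma cumulant_seqD (s1 s2 : seq AG) (a b : AG) :
  cumulant_seq (s1 ++ (a + b) :: s2) =
  cumulant_seq (s1 ++ a :: s2) + cumulant_seq (s1 ++ b :: s2).
Proof.
pose n := (size s1 + (size s2).+1)%N.
have sz c : size (s1 ++ c :: s2) == n by rewrite size_cat.
have cE c : cumulant_seq (s1 ++ c :: s2) = cumulant (Tuple (sz c)).
  exact: eq_cumulant.
have jn : (size s1 < n)%N by rewrite /n addnS ltnS leq_addr.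
rewrite !cE; apply: (@cumulantD_slot _ (Ordinal jn)) => [|i ij].
  by rewrite !(tnth_nth 0) /= !nth_cat ltnn subnn.
have eqc c c' : tnth (Tuple (sz c)) i = tnth (Tuple (sz c')) i.
  rewrite !(tnth_nth 0) /= !nth_cat; case: ltnP => // le.
  have : (0 < i - size s1)%N by rewrite subn_gt0 ltn_neqAle le andbT eq_sym.
  by case: (i - size s1)%N.
by split; apply: eqc.
Qed.

Section Free.
Variables (x y : AG) (xy_free : G_free x y).

Definition either (b : bool) : AG := if b then y else x.

Lemma cumulant_mixed (c : seq bool) :
  (1 < size c)%N -> ~~ constant c -> cumulant_seq (map either c) = 0.
Proof.
move=> c1 ncst.
rewrite /cumulant_seq -(@eq_cumulant _ _ (map_tuple either (in_tuple c))) //.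
apply: (@xy_free _ (in_tuple c) _ c1 ncst) => j; rewrite tnth_map.
by rewrite /either; case: ifP => _; apply: sub_gen_smallest; left.
Qed.

(** A nonconstant prefix stays nonconstant whichever letter is appended, so both terms from
    expanding the first [x + y] vanish by induction. *)
Lemma cumulant_mixed_prefix (c : seq bool) (m : nat) :
  (1 < size c)%N -> ~~ constant c ->
  cumulant_seq (map either c ++ nseq m (x + y)) = 0.
Proof.
elim: m c => [|m IHm] c c1 ncst; first by rewrite cats0 cumulant_mixed.
have ncst_rcons b : ~~ constant (rcons c b).
  by case: c {c1} ncst => //= a c; rewrite all_rcons negb_and orbC => ->.
have IHrcons b :
    cumulant_seq (rcons (map either c) (either b) ++ nseq m (x + y)) = 0.
  by rewrite -map_rcons IHm // size_rcons ltnW.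
by rewrite /= cumulant_seqD -!cat_rcons (IHrcons false) (IHrcons true) addr0.
Qed.

(** Expanding the next sum, the letter [~~ b] makes the prefix mixed and its term vanishes; the
    letter [b] lengthens the prefix. The prefix must be nonempty for [~~ b] to clash with it. *)
Lemma cumulant_const_prefix (b : bool) (a m : nat) :
  cumulant_seq (nseq a.+1 (either b) ++ nseq m (x + y)) =
  cumulant_seq (nseq (a.+1 + m) (either b)).
Proof.
elim: m a => [|m IHm] a; first by rewrite cats0 addn0.
have mixed : cumulant_seq (nseq a.+1 (either b) ++ either (~~ b) :: nseq m (x + y)) = 0.
  rewrite -cat_rcons -map_nseq -map_rcons cumulant_mixed_prefix //=.
    by rewrite size_rcons.
  by rewrite all_rcons negb_and /=; case: (b).
rewrite addnS -addSn -IHm -[in RHS](addn1 a.+1) nseqD cats1 cat_rcons.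
rewrite [nseq m.+1 (x + y)]/= cumulant_seqD.
by case: (b) mixed => ->; rewrite ?addr0 ?add0r.
Qed.

Lemma cumulantD_free (n : nat) :
  cumulant_seq (nseq n.+1 (x + y)) =
  cumulant_seq (nseq n.+1 x) + cumulant_seq (nseq n.+1 y).
Proof.
rewrite [nseq _ (x + y)]/= (cumulant_seqD [::]) /=.
have := cumulant_const_prefix false 0 n; rewrite /= => ->.
by have := cumulant_const_prefix true 0 n; rewrite /= => ->.
Qed.

End Free.

Lemma graph_R_cons (s : nat) (x : s.-tuple AG) (i : 'I_s) (w : seq 'I_s) :
  graph_R x (i :: w) = cumulant_seq (map (tnth x) (i :: w)).
Proof. exact: eq_cumulant. Qed.

Lemma graph_R1_cons (x : AG) (i : 'I_1) (w : seq 'I_1) :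
  graph_R [tuple x] (i :: w) = cumulant_seq (nseq (size w).+1 x).
Proof.
rewrite graph_R_cons; congr cumulant_seq.
rewrite -[(size w).+1]/(size (i :: w)) -(size_map (tnth [tuple x]) (i :: w)).
by apply/all_pred1P/allP => _ /mapP[j _ ->] /=; rewrite ord1.
Qed.

Lemma graph_R1_nseq (x : AG) (n : nat) :
  graph_R [tuple x] (nseq n.+1 ord0) = cumulant_seq (nseq n.+1 x).
Proof. by rewrite (graph_R1_cons x ord0 (nseq n ord0)) size_nseq. Qed.

End Cumulants.

Theorem proposition2p2 (R : realType) (G : sgraph) (A : G -> ncprob R[i])
    (x y : graph_alg A) (xy_free : G_free x y) :
  graph_R [tuple x + y] = graph_R [tuple x] + graph_R [tuple y]
  /\
  graph_R [tuple x; y] =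
    in_var (ord0 : 'I_2) (graph_R [tuple x])
    + in_var (ord_max : 'I_2) (graph_R [tuple y]).
Proof.
split; apply/funext => -[|i w]; rewrite -[RHS]/(_ _ + _ _).
- by rewrite /= addr0.
- by rewrite !graph_R1_cons cumulantD_free.
- by rewrite /in_var /= addr0.
rewrite graph_R_cons /in_var.
(* Translates the word into the boolean labels of [either]: [true] stands for [y]. *)
pose c := [seq j == ord_max | j <- i :: w].
have cE : map (tnth [tuple x; y]) (i :: w) = map (either x y) c.
  rewrite -map_comp; apply: eq_map => j /=.
  by rewrite (tnth_nth 0); case: j => -[|[|[]]].
have nseqE (j : 'I_2) : all (pred1 j) (i :: w) ->
    cumulant_seq (map (tnth [tuple x; y]) (i :: w)) =
    cumulant_seq (nseq (size w).+1 (tnth [tuple x; y] j)).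
  by move=> /all_pred1P ->; rewrite map_nseq.
have [w0|w0] := boolP (all (pred1 ord0) (i :: w)).
  (* The word is nonempty, so it cannot also be constant equal to [ord_max]: the second series
     contributes 0. *)
  rewrite (nseqE _ w0) ifN; last first.
    by case/andP: w0 => /eqP -> _.
  by rewrite addr0 graph_R1_nseq.
have [w1|w1] := boolP (all (pred1 ord_max) (i :: w)).
  by rewrite (nseqE _ w1) add0r graph_R1_nseq.
have ncst : ~~ constant c.
  apply/negP => /(constantP false)[b cb]; case: b cb => cb.
    case/negP: w1; apply/allP => j jw.
    have : (j == ord_max) \in c by apply/mapP; exists j.
    by rewrite cb => /nseqP[/= -> _].
  case/negP: w0; apply/allP => j jw.
  have : (j == ord_max) \in c by apply/mapP; exists j.
  rewrite cb => /nseqP[+ _]; rewrite /= -!val_eqE.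
  by case: j {jw} => -[|[|[]]].
(* A one-letter word is constant, so nonconstancy also gives the length bound. *)
rewrite cE addr0 (cumulant_mixed xy_free) // ltnNge.
by apply: contra ncst; rewrite /c; case: (w).
Qed.
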